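(* Let $p,q$ be positive integers with $p<q$. Then there exists a (finite, connected) planar multigraph $G$ such that $\mathrm{dep}(G)=p/q$.
   Context: A multigraph is a graph in which multiple (parallel) edges are allowed; parallel edges are regarded as distinct edges. For a connected multigraph $G$, $\tau(G)$ is the number of spanning trees of $G$ (counted as edge sets), and for $e\in E(G)$, $\tau_G(e)$ is the number of spanning trees of $G$ containing $e$. The spanning tree edge density of $e$ is $d_G(e)=\tau_G(e)/\tau(G)$, and the spanning tree edge dependence of $G$ is $\mathrm{dep}(G)=\max_{e\in E(G)}d_G(e)$. *)

(* Defs.v *)
From HB Require Import structures.
From mathcomp Require Import all_boot all_order all_algebra.
From mathcomp Require Import all_classical all_reals all_analysis.
Import Order.TTheory GRing.Theory Num.Theory.
Import numFieldNormedType.Exports.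

Set Implicit Arguments.
Unset Strict Implicit.
Unset Printing Implicit Defensive.

Local Open Scope ring_scope.

(* Finite loopless multigraphs: distinct elements of [edge] may have the same
   pair of ends. *)
Record multigraph := Multigraph {
  vertex : finType;
  edge : finType;
  ends : edge -> {set vertex};
  card_ends : forall e : edge, #|ends e| = 2%N
}.

Section Multigraph.
Variable G : multigraph.
Implicit Types (T : {set edge G}) (e : edge G).

Definition adjacent T (u v : vertex G) : bool :=
  [exists e in T, ends e == [set u; v]%SET].

(* The spanning subgraph (V(G), T) is connected; as usual, a connected graph
   has at least one vertex. *)
Definition spanning_connected T : Prop :=
  (0 < #|vertex G|)%N /\ forall u v : vertex G, connect (adjacent T) u v.

Definition graph_connected : Prop := spanning_connected [set: edge G]%SET.

(* The sequence (v_0, e_0), ..., (v_(k-1), e_(k-1)) encodes the closed walk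
   v_0 e_0 v_1 ... v_(k-1) e_(k-1) v_0; two parallel edges form a cycle of
   length 2. *)
Definition is_cycle (c : seq (vertex G * edge G)) : Prop :=
  [/\ (2 <= size c)%N,
      uniq [seq x.1 | x <- c],
      uniq [seq x.2 | x <- c] &
      cycle (fun x y => ends x.2 == [set x.1; y.1]%SET) c].

Definition acyclic T : Prop :=
  ~ exists c, is_cycle c /\ {subset [seq x.2 | x <- c] <= T}.

Definition spanning_tree T : Prop := spanning_connected T /\ acyclic T.

Definition tau : nat := #|[set T : {set edge G} | `[< spanning_tree T >]]%SET|.

Definition tau_edge e : nat :=
  #|[set T : {set edge G} | `[< spanning_tree T >] & e \in T]%SET|.

Definition density e : rat := (tau_edge e)%:R / tau%:R.

(* Densities are nonnegative, so the default value 0 of the iterated maximum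
   only matters when G has no edge. *)
Definition dep : rat := \big[Num.max/0]_(e : edge G) density e.

(* Drawings in the plane R^2: edges are simple arcs joining the images of their
   ends, whose interiors avoid all vertices and each other. *)
Record plane_drawing (R : realType)
    (pos : vertex G -> R * R) (arc : edge G -> R -> R * R) : Prop := {
  pos_inj : injective pos;
  arc_continuous : forall e, {within `[0, 1], continuous (arc e)}%classic;
  arc_inj : forall e, {in `[0, 1] &, injective (arc e)};
  arc_ends : forall e, exists u v : vertex G,
    [/\ ends e = [set u; v]%SET, arc e 0 = pos u & arc e 1 = pos v];
  arc_vertex : forall e (t : R) (v : vertex G),
    t \in `]0, 1[ -> arc e t <> pos v;
  arc_disjoint : forall e f (s t : R),
    e != f -> s \in `]0, 1[ -> t \in `]0, 1[ -> arc e s <> arc f t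
}.

Definition planar (R : realType) : Prop :=
  exists (pos : vertex G -> R * R) (arc : edge G -> R -> R * R),
    plane_drawing pos arc.

End Multigraph.

(* Main.v *)
(** Let [k = q - p], and let [G] be a cycle of length [p + 1] in which all edges
    but one are replaced by [k] parallel edges. A spanning tree of a cycle with
    class multiplicities [m_i] omits one class and picks one edge from each
    other class, so with [S = sum_i 1 / m_i] an edge of class [i] has density
    [(1 / m_i) (1 - (1 / m_i) / S)]. Here [S = q / k]: the single edge has
    density [p / q] and the others [(q - 1) / (k q)], which is at most [p / q]
    since [(p - 1) (q - p - 1) >= 0]. *)
Require Import Defs.
From mathcomp Require Import all_boot all_order all_algebra.
From mathcomp Require Import all_classical all_reals all_analysis.
From mathcomp Require Import zify ring lra.
Import Order.TTheory GRing.Theory Num.Theory.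
Import numFieldNormedType.Exports.

Set Implicit Arguments.
Unset Strict Implicit.
Unset Printing Implicit Defensive.

Local Open Scope classical_set_scope.
Local Open Scope ring_scope.

Lemma uniq_map_inj (T U : eqType) (f : T -> U) (s : seq T) :
  uniq [seq f x | x <- s] -> {in s &, injective f}.
Proof.
elim: s => [//|z s IHs] /= /andP[zs us] x y; rewrite !inE.
move=> /predU1P[->|xs] /predU1P[->|ys] // fxy; last exact: IHs.
  by rewrite fxy map_f in zs.
by rewrite -fxy map_f in zs.
Qed.

(** * Counting transversals of a family of classes *)

Section Transversals.
Variables (E I : finType) (cl : E -> I).
Implicit Types (T A : {set E}) (D : {set I}).

(* The second conjunct says that [cl] is injective on [T]. *)
Definition class_transversal D T := (cl @: T == D) && (#|cl @: T| == #|T|).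

Lemma class_transversal_inj D T : class_transversal D T -> {in T &, injective cl}.
Proof. by case/andP=> _ /imset_injP. Qed.

(** A transversal amounts to an independent choice, for each class in [D], of one of its elements
    lying in [A]. *)
Lemma card_class_transversals D A :
  #|[set T : {set E} | (T \subset A) && class_transversal D T]%SET| =
  (\prod_(i in D) #|[set e in A | cl e == i]%SET|)%N.
Proof.
(* Choices are functions with default [None]; since [F i] excludes [None], the support of a choice
   is exactly [D], and [gr] recovers the transversal. *)
pose F i : pred (option E) :=
  fun o => if o is Some e then (e \in A) && (cl e == i) else false.
pose gr (g : {ffun I -> option E}) := [set e | g (cl e) == Some e]%SET.
have memP g : g \in pfamily None D F ->
    (forall i, i \in D -> exists e, [/\ g i = Some e, e \in A & cl e = i]) /\
    (forall i, i \notin D -> g i = None).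
  case/pfamilyP=> /fintype.subsetP sgD gF; split=> i iD.
    have := gF i iD; rewrite unfold_in; case: (g i) => // e /andP[eA /eqP ei].
    by exists e.
  by apply/eqP; apply: contraNT iD => gi; apply: sgD.
transitivity #|pfamily None D F|; last first.
  rewrite card_pfamily foldrE big_image /=; apply: eq_bigr => i _.
  rewrite -(card_imset _ Some_inj); apply: eq_card => -[e|] /=.
    by rewrite mem_imset ?inE //; exact: Some_inj.
  by apply/esym/negbTE/imsetP => -[].
rewrite -(@card_in_imset _ _ gr); last first.
  move=> g h /memP[gD gN] /memP[hD hN] /setP gh; apply/ffunP => i.
  have [iD|iD] := boolP (i \in D); last by rewrite gN // hN.
  have [e [ge _ ei]] := gD i iD.
  by have := gh e; rewrite !inE ei ge eqxx => /esym/eqP.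
apply: eq_card => T; rewrite inE; apply/idP/imsetP => [|[g /memP[gD gN] ->]].
  case/andP=> /fintype.subsetP TA tT.
  have injT := class_transversal_inj tT; case/andP: tT => /eqP clT _.
  exists [ffun i => [pick e in T | cl e == i]].
    apply/pfamilyP; split.
      apply/fintype.subsetP => i; rewrite inE ffunE; case: pickP => // e.
      by case/andP=> eT /eqP <- _; rewrite -clT imset_f.
    move=> i; rewrite -clT => /imsetP[e eT ->]; rewrite unfold_in ffunE.
    case: pickP => [f /andP[/TA -> ->] //|/(_ e)].
    by rewrite eT eqxx.
  apply/setP => e; rewrite inE ffunE; case: pickP => [f /andP[fT /eqP fe]|].
    by apply/idP/eqP => [eT|[<-]//]; congr Some; apply: injT.
  by move=> /(_ e); rewrite eqxx andbT => ->.
apply/andP; split.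
  apply/fintype.subsetP => e; rewrite inE => /eqP ge.
  have [ceD|/gN] := boolP (cl e \in D); last by rewrite ge.
  by have [f [+ fA _]] := gD _ ceD; rewrite ge => -[->].
apply/andP; split; last first.
  apply/imset_injP => e f; rewrite !inE => /eqP ge /eqP gf ef.
  by move: ge; rewrite ef gf => -[].
apply/eqP/setP => i; apply/imsetP/idP => [[e + ->]|/gD[e [ge _ ei]]].
  by rewrite inE => /eqP ge; apply: contraT => /gN; rewrite ge.
by exists e => //; rewrite inE ei ge.
Qed.

End Transversals.

(** * Successors modulo n + 2 *)

Lemma ordS_neq n (x : 'I_n.+2) : x != x + 1.
Proof. by rewrite -[X in X == _]addr0 (inj_eq (addrI _)) eq_sym oner_eq0. Qed.

Lemma val_ordS n (x : 'I_n.+2) : x != -1 -> (x + 1 : 'I_n.+2) = x.+1 :> nat.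
Proof.

move=> x1; have xn : (x.+1 < n.+2)%N.
  rewrite ltn_neqAle ltn_ord andbT; apply: contraNneq x1 => xn.
  by rewrite -subr_eq0 opprK; apply/eqP/val_inj; rewrite /= modnDmr addn1 xn modnn.
by rewrite /= modnDmr addn1 modn_small.
Qed.

Lemma val_ordN1 n : (-1 : 'I_n.+2) = n.+1 :> nat.
Proof. by rewrite /= (@modn_small 1) // subn1 modn_small. Qed.

(** * Spanning trees of a cycle with multiplied edges *)

Section FatCycle.
Variables (n : nat) (E : finType) (cl : E -> 'I_n.+2).

Lemma card_fat_cycle_ends e : #|[set cl e; cl e + 1]%SET| = 2%N.
Proof. by rewrite cards2 ordS_neq. Qed.

(** For [n = 0] both classes have the same pair of ends, so classes are tracked by [cl] rather than
    read off the ends. *)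
Definition fat_cycle : multigraph := Multigraph card_fat_cycle_ends.

Implicit Types (T A : {set edge fat_cycle}).

Lemma fat_cycle_adjacent T e :
  e \in T -> @Defs.adjacent fat_cycle T (cl e) (cl e + 1).
Proof. by move=> eT; apply/existsP; exists e; rewrite eT /=. Qed.

Lemma fat_cycle_adjacent_sym T : symmetric (@Defs.adjacent fat_cycle T).
Proof. by move=> u v; rewrite /Defs.adjacent; under eq_existsb do rewrite finset.setUC. Qed.


(** Walking upwards from [i0 + 1] reaches every vertex, ending at [i0], without ever using class
    [i0]. *)
Lemma fat_cycle_connected T i0 : [set~ i0]%SET \subset cl @: T ->
  @spanning_connected fat_cycle T.
Proof.
move=> /fintype.subsetP sT; split=> [|u v]; first by rewrite card_ord.
have csym := sym_connect_sym (@fat_cycle_adjacent_sym T).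
suff H w : connect (@Defs.adjacent fat_cycle T) (i0 + 1) w.
  by apply: connect_trans (H v); rewrite csym.
suff {w} Ht (t : nat) : (t < n.+2)%N ->
    connect (@Defs.adjacent fat_cycle T) (i0 + 1) (i0 + 1 + t%:R).
  have -> : w = i0 + 1 + ((w - (i0 + 1))%R : 'I_n.+2)%:R.
    by rewrite natr_Zp addrC subrK.
  exact: Ht.
elim: t => [|t IHt] tn; first by rewrite addr0.
apply: connect_trans (IHt (ltnW tn)) _; apply: connect1.
rewrite -natr1 addrA.
have /sT/imsetP[e eT ->] : i0 + 1 + t%:R \in [set~ i0]%SET; last first.
  exact: fat_cycle_adjacent.
(* Meeting [i0] here would mean that t + 1 vanishes modulo n + 2, although [t.+1 < n.+2]. *)
rewrite !inE -addrA -[X in _ == X]addr0 (inj_eq (addrI _)) nat1r.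
by apply/eqP => /(congr1 val); rewrite /= Zp_nat /= modn_small.
Qed.

(* Removing two classes leaves the arc from [i + 1] to [j] as a union of
   components; it misses [i]. *)
Lemma fat_cycle_disconnected T i j : i != j -> i \notin cl @: T ->
  j \notin cl @: T -> ~ @spanning_connected fat_cycle T.
Proof.
move=> ij iT jT [_ conn].
pose y := j - (i + 1).
pose P : {pred 'I_n.+2} := fun v => (((v - (i + 1))%R : 'I_n.+2) <= y)%N.
have csym := sym_connect_sym (@fat_cycle_adjacent_sym T).
(* Along an edge of [T] the distance from [i + 1] grows by one: it cannot wrap around, as class [i]
   is absent, nor pass the bound [y], as class [j] is absent. *)
have Pe e : e \in T -> P (cl e + 1) = P (cl e).
  move=> eT; rewrite /P addrAC val_ordS; last first.
    rewrite subr_eq addrC addrK; apply: contraNneq iT => <-.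
    exact: imset_f.
  rewrite [RHS]leq_eqVlt; suff /negbTE -> : cl e - (i + 1) != y :> nat by [].
  rewrite (inj_eq val_inj) (inj_eq (addIr _)).
  by apply: contraNneq jT => <-; exact: imset_f.
have clP : fingraph.closed (@Defs.adjacent fat_cycle T) P.
  apply: intro_closed => // u v /existsP[e /andP[eT /eqP euv]].
  have uE : u \in @ends fat_cycle e by rewrite euv !inE eqxx.
  have vE : v \in @ends fat_cycle e by rewrite euv !inE eqxx orbT.
  move: uE vE; rewrite /= !inE.
  by move=> /orP[]/eqP-> /orP[]/eqP->; rewrite !unfold_in -!/(P _) ?Pe.
have := closed_connect clP (conn (i + 1) i).
rewrite !unfold_in subrr leq0n opprD addrA subrr add0r val_ordN1 => /esym.
rewrite leqNgt -ltnS -val_ordS ?ltn_ord //.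
by rewrite subr_eq addrC addrK eq_sym.
Qed.

(* A highest vertex on a cycle meets two edges of the class just below it. *)
Lemma fat_cycle_acyclic T i0 : {in T &, injective cl} -> i0 \notin cl @: T ->
  @acyclic fat_cycle T.
Proof.
move=> injT i0T [c [[c2 uv ue cyc] cT]].
(* Heights start at [i0 + 1], so that they would drop only across the missing class [i0]. *)
pose h (v : 'I_n.+2) : nat := (v - (i0 + 1) : 'I_n.+2).
have hS e : e \in T -> h (cl e + 1) = (h (cl e)).+1.
  move=> eT; rewrite /h addrAC val_ordS // subr_eq addrC addrK.
  by apply: contraNneq i0T => <-; exact: imset_f.
case: c => [//|x0 c] in c2 uv ue cyc cT *.
have [x xc xmax] := @arg_maxnP _ x0 (mem (x0 :: c)) (fun x => h x.1) (mem_head _ _).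
have up e (v : 'I_n.+2) : e \in T -> (h v <= h x.1)%N ->
    [set cl e; cl e + 1]%SET = [set x.1; v]%SET -> cl e + 1 = x.1.
  move=> eT hv eE.
  have : cl e + 1 \in [set x.1; v]%SET by rewrite -eE !inE eqxx orbT.
  have : cl e \in [set x.1; v]%SET by rewrite -eE !inE eqxx.
  have := hS e eT; rewrite !inE => + /orP[]/eqP ce /orP[]/eqP // cS.
  - by rewrite cS ce; lia.
  - by rewrite cS ce; lia.
have inT z : z \in x0 :: c -> z.2 \in T by move=> zc; apply: cT; apply: map_f.
have px : prev (x0 :: c) x \in x0 :: c by rewrite mem_prev.
have nx : next (x0 :: c) x \in x0 :: c by rewrite mem_next.
have /eqP Ep := prev_cycle cyc xc.
have /eqP En := next_cycle cyc xc.
have e1 := up _ _ (inT _ xc) (xmax _ nx) En.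
have e2 : cl (prev (x0 :: c) x).2 + 1 = x.1.
  apply: (up _ (prev (x0 :: c) x).1 (inT _ px) (xmax _ px)).
  by rewrite [RHS]finset.setUC.
(* Both cycle edges at the highest vertex are in the class below it, hence equal; the cycle then has
   [x] as its own predecessor, which would make [x.2] a loop. *)
have e12 : (prev (x0 :: c) x).2 = x.2.
  by apply: injT; rewrite ?inT //; apply: (addIr 1); rewrite e1 e2.
have pxE : prev (x0 :: c) x = x.
  exact: (uniq_map_inj ue px xc e12).
by have := card_ends x.2; rewrite -{1}pxE Ep pxE finset.setUid cards1.
Qed.

Lemma fat_cycle_parallel T e f : e \in T -> f \in T -> e != f -> cl e = cl f ->
  ~ @acyclic fat_cycle T.
Proof.
move=> eT fT ef cef; apply.
exists [:: (cl e, e); (cl e + 1, f)]; split; last first.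
  by move=> g; rewrite !inE => /orP[]/eqP->.
split=> //=.
- by rewrite inE ordS_neq.
- by rewrite inE ef.
by rewrite eqxx -cef finset.setUC eqxx.
Qed.

(** One edge of [T] from each class, taken in cyclic order, closes up. *)
Lemma fat_cycle_full T : cl @: T = [set: 'I_n.+2]%SET -> ~ @acyclic fat_cycle T.
Proof.
move=> clT; apply.
have ex i : exists e, (e \in T) && (cl e == i).
  have : i \in cl @: T by rewrite clT inE.
  by case/imsetP => e eT ->; exists e; rewrite eT eqxx.
pose s i := xchoose (ex i).
have sT i : s i \in T by have /andP[] := xchooseP (ex i).
have sK : cancel s cl by move=> i; have /andP[_ /eqP] := xchooseP (ex i).
pose o := orbit (fun x : 'I_n.+2 => x + 1) ord0.
have inj1 : injective (fun x : 'I_n.+2 => x + 1) by exact: addIr.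
exists [seq (i, s i) | i <- o]; split; last first.
  by move=> _ /mapP[_ /mapP[i _ ->] ->]; exact: sT.
split; rewrite -?map_comp.
- rewrite size_map size_orbit; case E1: order => [|[|//]].
    by have := fingraph.order_gt0 (fun x : 'I_n.+2 => x + 1) ord0; rewrite E1.
  have := iter_order inj1 ord0; rewrite E1 /= => /esym/eqP.
  by rewrite (negbTE (ordS_neq _)).
- by rewrite map_id_in // orbit_uniq.
- by rewrite map_inj_uniq ?orbit_uniq //; exact: can_inj sK.
rewrite cycle_map; apply: sub_cycle (cycle_orbit inj1 _) => i j /= /eqP <-.
by rewrite sK.
Qed.

(** Connectedness allows at most one missing class; acyclicity forces at least one and forbids two
    edges in the same class. *)
Lemma fat_cycle_spanning_tree T :
  @spanning_tree fat_cycle T <-> exists i0, class_transversal cl [set~ i0]%SET T.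
Proof.
split=> [[conn acyc]|[i0 tT]]; last first.
  have [/eqP clT _] := andP tT; split.
    by apply: (@fat_cycle_connected _ i0); rewrite clT.
  apply: (@fat_cycle_acyclic _ i0 (class_transversal_inj tT)).
  by rewrite clT !inE eqxx.
have [i0 i0T] : exists i0, i0 \notin cl @: T.
  apply/existsP; apply: contraT; rewrite negb_exists => /forallP full.
  case: (fat_cycle_full _ acyc).
  by apply/setP => i; rewrite inE; have := full i; rewrite negbK.
exists i0; apply/andP; split; last first.
  apply/imset_injP => e f eT fT cef; apply/eqP; apply: contraT => ef.
  by case: (fat_cycle_parallel eT fT ef cef acyc).
apply/eqP/setP => i; rewrite !inE; apply/idP/idP => [iT|].
  by apply: contraNneq i0T => <-.
move=> ii0; apply: contraT => iT.
by have := fat_cycle_disconnected ii0 iT i0T.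
Qed.

End FatCycle.

(** * Tree counts and edge densities *)

Section FatCycleDensity.
Variables (n : nat) (E : finType) (cl : E -> 'I_n.+2).
Implicit Types (T A : {set E}).

(** The restrictions to [A] and [J] let one count serve both for all trees and for those through a
    given edge. Each tree is counted once because it determines the class it omits. *)
Lemma card_omitting A (J : {pred 'I_n.+2}) :
  #|[set T : {set E} | (T \subset A) &&
     [exists i0 in J, class_transversal cl [set~ i0]%SET T]]%SET| =
  (\sum_(i0 in J) \prod_(i in [set~ i0]%SET) #|[set e in A | cl e == i]%SET|)%N.
Proof.
under eq_bigr => i0 _ do rewrite -card_class_transversals -sum1_card big_mkcond.
rewrite exchange_big -sum1_card big_mkcond /=; apply: eq_bigr => T _.
rewrite inE; case: andP => [[TA /existsP[i1 /andP[i1J tT]]]|nT]; last first.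
  rewrite big1 // => i0 i0J; rewrite inE; case: andP => // -[TA tT]; case: nT.
  by split=> //; apply/existsP; exists i0; apply/andP.
rewrite (bigD1 i1) //= inE TA tT big1 ?addn0 // => i0 /andP[_ i01].
rewrite inE TA /=; case: ifP => // /andP[/eqP tT' _]; move: tT => /andP[].
by rewrite tT' (inj_eq (@finset.setC_inj _)) (inj_eq (@finset.set1_inj _)) (negbTE i01).
Qed.

Definition multiplicity (i : 'I_n.+2) : nat := #|[set e | cl e == i]%SET|.

Hypothesis multiplicity_gt0 : forall i, (0 < multiplicity i)%N.

Let m i : rat := (multiplicity i)%:R.
Let M := \prod_i m i.
Let S := \sum_i (m i)^-1.

Let m_neq0 i : m i != 0. Proof. by rewrite pnatr_eq0 -lt0n. Qed.

Lemma fat_cycle_tau : (tau (fat_cycle cl))%:R = M * S.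
Proof.
pose J : {pred 'I_n.+2} := predT.
transitivity ((\sum_(i0 in J) \prod_(i in [set~ i0]%SET)
    #|[set e in [set: E] | cl e == i]%SET|)%N%:R : rat).
  congr _%:R; rewrite -card_omitting; apply: eq_card => T; rewrite !inE.
  rewrite finset.subsetT; apply/asboolP/existsP => [/fat_cycle_spanning_tree//|].
  by move=> [i0 /andP[_ tT]]; apply/fat_cycle_spanning_tree; exists i0.
rewrite natr_sum mulr_sumr; apply: eq_bigr => i0 _.
rewrite [M](bigD1 i0) //= [RHS]mulrC mulKf // natr_prod.
apply: eq_big => [i|i _]; rewrite ?inE //.
by congr _%:R; apply: eq_card => e; rewrite !inE.
Qed.

Lemma fat_cycle_tau_edge e : (@tau_edge (fat_cycle cl) e)%:R =
  M / m (cl e) * (S - (m (cl e))^-1).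
Proof.
(* A tree contains [e] exactly when it does not omit the class of [e] and avoids the other edges of
   that class, which [A] deletes. *)
pose J : {pred 'I_n.+2} := predC1 (cl e).
pose A := [set f | (cl f == cl e) ==> (f == e)]%SET.
transitivity ((\sum_(i0 in J) \prod_(i in [set~ i0]%SET)
    #|[set f in A | cl f == i]%SET|)%N%:R : rat).
  congr _%:R; rewrite -card_omitting; apply: eq_card => T; rewrite !inE.
  apply/andP/andP => [[/asboolP/fat_cycle_spanning_tree[i0 tT] eT]|].
    have clT : cl @: T = [set~ i0]%SET by case/andP: tT => /eqP.
    split; last first.
      apply/existsP; exists i0; rewrite tT andbT inE /= eq_sym -finset.in_setC1 -clT.
      exact: imset_f.
    apply/fintype.subsetP => f fT; rewrite inE; apply/implyP => /eqP fe.
    by apply/eqP; apply: (class_transversal_inj tT).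
  move=> [/fintype.subsetP TA /existsP[i0 /andP[ci0 tT]]]; split.
    by apply/asboolP/fat_cycle_spanning_tree; exists i0.
  have : cl e \in cl @: T by case/andP: tT => /eqP -> _; rewrite !inE eq_sym.
  by case/imsetP => f fT ef; have := TA f fT; rewrite inE ef eqxx => /eqP <-.
rewrite natr_sum [S](bigD1 (cl e)) //= addrAC subrr add0r mulr_sumr.
apply: eq_bigr => i0 i0e; rewrite natr_prod.
have ce : cl e \in [set~ i0]%SET by rewrite !inE eq_sym.
rewrite (bigD1 (cl e)) //= [M](bigD1 i0) //=.
rewrite [\prod_(i | i != i0) m i](bigD1 (cl e)) /=; last by rewrite eq_sym.
have -> : #|[set f in A | cl f == cl e]%SET| = 1%N.
  rewrite -(cards1 e); apply: eq_card => f; rewrite !inE.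
  by case: (f =P e) => [->|_]; rewrite ?eqxx //; case: (cl f == cl e).
rewrite mul1r mulrCA [m (cl e) * _]mulrC mulfK // [m i0 * _]mulrC mulfK //.
apply: eq_big => [i|i /andP[_ ie]]; rewrite ?inE //.
congr _%:R; apply: eq_card => f; rewrite !inE.
by case: (cl f =P i) => [->|]; rewrite ?andbF // (negbTE ie).
Qed.

Lemma fat_cycle_density e :
  @density (fat_cycle cl) e = (m (cl e))^-1 * (1 - (m (cl e))^-1 / S).
Proof.
have M0 : M != 0 by apply/prodf_neq0 => i _.
have S0 : S != 0.
  rewrite gt_eqF // /S (bigD1 ord0) //= ltr_pwDl ?invr_gt0 ?ltr0n //.
  by apply: sumr_ge0 => i _; rewrite invr_ge0 ler0n.
rewrite /density fat_cycle_tau fat_cycle_tau_edge; field.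
by rewrite M0 S0 m_neq0.
Qed.

End FatCycleDensity.

(* The vertices lie on the horizontal axis; the class of [-1], joining the two
   extreme vertices, is drawn below the axis and the others on or above it, by
   parabolas whose heights separate parallel edges. *)
Lemma fat_cycle_planar (R : realType) n (E : finType) (cl : E -> 'I_n.+2) :
  planar (fat_cycle cl) R.
Proof.
pose pos (v : vertex (fat_cycle cl)) : R * R := ((v : 'I_n.+2)%:R, 0).
pose r (e : E) : R := (enum_rank e)%:R.
have r_inj : injective r.
  move=> e f /eqP; rewrite eqr_nat => /eqP/val_inj; exact: enum_rank_inj.
have r_ge0 e : 0 <= r e by exact: ler0n.
(* Left abscissa, width and signed height factor of each parabola. The [+ 1] in [h] keeps the class
   of [-1] strictly below the axis even at rank 0. *)
pose b (e : E) : R := if cl e == -1 then 0 else (cl e)%:R.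
pose w (e : E) : R := if cl e == -1 then n.+1%:R else 1.
pose h (e : E) : R := if cl e == -1 then - (r e + 1) else r e.
have w0 e : w e != 0 by rewrite /w; case: ifP; rewrite ?oner_eq0 // pnatr_eq0.
pose arc (e : edge (fat_cycle cl)) (t : R) : R * R :=
  (b e + w e * t, h e * (t * (1 - t))).
have bump (t : R) : t \in `]0, 1[%R -> 0 < t * (1 - t).
  by rewrite in_itv /= => /andP[t0 t1]; rewrite mulr_gt0 // subr_gt0.
exists pos, arc; split.
- by move=> u v [] /eqP; rewrite eqr_nat => /eqP/val_inj.
- move=> e; apply: continuous_subspaceT => t.
  have c1 : b e + w e * x @[x --> t] --> b e + w e * t.
    by apply: cvgD; [exact: cvg_cst|apply: cvgM; [exact: cvg_cst|exact: cvg_id]].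
  have c2 : h e * (x * (1 - x)) @[x --> t] --> h e * (t * (1 - t)).
    apply: cvgM; first exact: cvg_cst.
    apply: cvgM; first exact: cvg_id.
    by apply: cvgB; [exact: cvg_cst|exact: cvg_id].
  exact: cvg_pair c1 c2.
- by move=> e s t _ _ [] /addrI /(mulfI (w0 e)).
- move=> e; rewrite /arc /pos /b /w; case: eqP => [e1|/eqP e1].
    exists ord0, (-1 : 'I_n.+2); split.
    + by rewrite /= e1 addNr finset.setUC.
    + by rewrite mulr0 addr0 mul0r mulr0.
    + by rewrite val_ordN1 mulr1 add0r subrr mulr0 mulr0.
  exists (cl e), (cl e + 1); split=> //.
  + by rewrite mulr0 addr0 mul0r mulr0.
  + by rewrite val_ordS // mulr1 natr1 subrr mulr0 mulr0.
(* Interior points of class [-1] have negative ordinate; those of other classes have abscissa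
   strictly between consecutive integers. *)
- move=> e t v t01; rewrite /arc /pos /b /w /h; case: eqP => e1 [] xE yE.
    have := bump t t01; have := r_ge0 e; nra.
  move: t01 xE; rewrite mul1r in_itv /= => /andP[t0 t1] xE.
  have : (cl e)%:R < (v : 'I_n.+2)%:R :> R by lra.
  have : (v : 'I_n.+2)%:R < (cl e).+1%:R :> R by rewrite -natr1; lra.
  by rewrite !ltr_nat; lia.
move=> e f s t ef s01 t01; rewrite /arc /b /w /h.
have rb := bump s s01; have tb := bump t t01.
have re := r_ge0 e; have rf := r_ge0 f.
(* In the two mixed cases the ordinates differ in sign. Otherwise equal abscissas give the same
   class and parameter, and equal ordinates then give equal ranks. *)
case: eqP => e1; case: eqP => f1 [] xE yE.
- have st : s = t by apply: (@mulfI _ n.+1%:R); rewrite ?pnatr_eq0 //; lra.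
  move: yE; rewrite st => /(mulIf (lt0r_neq0 tb)) /oppr_inj /addIr /r_inj.
  by apply/eqP.
- by nra.
- by nra.
move: (s01) (t01); rewrite !in_itv /= => /andP[s0 s1] /andP[t0 t1].
rewrite !mul1r in xE.
have ce : cl e = cl f :> nat.
  have : (cl e)%:R < (cl f).+1%:R :> R by rewrite -natr1; lra.
  have : (cl f)%:R < (cl e).+1%:R :> R by rewrite -natr1; lra.
  by rewrite !ltr_nat; lia.
have st : s = t by move: xE; rewrite ce => /addrI.
move: yE; rewrite st => /(mulIf (lt0r_neq0 tb)) /r_inj.
by apply/eqP.
Qed.

(** * Choice of multiplicities realizing p/q *)

Theorem corollary3p5 (R : realType) (p q : nat) (hp : (0 < p)%N)
    (hpq : (p < q)%N) :
  exists G : multigraph,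
    [/\ graph_connected G, planar G R & dep G = p%:R / q%:R].
Proof.
case: p hp hpq => [//|n] _ hpq.
pose k := (q - n.+1)%N; have k0 : (0 < k)%N by rewrite subn_gt0.
(* Here p is [n.+1]; [None] is the single edge, placed in the last class, and the pairs are the [k]
   copies in each other class. *)
pose E : finType := option ('I_n.+1 * 'I_k).
pose cl (e : E) : 'I_n.+2 :=
  if e is Some ij then widen_ord (leqnSn _) ij.1 else ord_max.
have mS (i : 'I_n.+1) : multiplicity cl (widen_ord (leqnSn _) i) = k.
  have inj : injective (fun j : 'I_k => Some (i, j) : E) by move=> j j' [].
  rewrite -[RHS]card_ord -(card_imset _ inj).
  apply: eq_card => -[[i' j]|]; rewrite !inE.
    apply/eqP/imsetP => [/(congr1 val) /= /val_inj ->|[j' _ [-> _]] //].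
    by exists j.
  by apply/eqP/imsetP => [/(congr1 val) /= /eqP|[]//]; rewrite gtn_eqF.
have mN : multiplicity cl ord_max = 1%N.
  rewrite /multiplicity -(cards1 (None : E)); apply: eq_card => -[[i j]|].
    rewrite !inE; apply/eqP => /(congr1 val) /= /eqP; rewrite ltn_eqF //.
  by rewrite !inE !eqxx.
have m0 i : (0 < multiplicity cl i)%N.
  case: (unliftP ord_max i) => [j ->|->]; last by rewrite mN.
  have -> : lift ord_max j = widen_ord (leqnSn _) j.
    by apply/val_inj; exact: lift_max.
  by rewrite mS.
have S_E : \sum_i (multiplicity cl i)%:R^-1 = q%:R / k%:R :> rat.
  rewrite big_ord_recr /= mN; under eq_bigr do rewrite mS.
  rewrite sumr_const card_ord.
  have -> : q = (n.+1 + k)%N by rewrite subnKC // ltnW.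
  by rewrite natrD -mulr_natl; field; rewrite pnatr_eq0 -lt0n.
have dE e := fat_cycle_density m0 e.
have q0 : (q%:R : rat) != 0 by rewrite pnatr_eq0 -lt0n (leq_trans _ hpq).
have kE : (k%:R : rat) = q%:R - n.+1%:R by rewrite natrB // ltnW.
have k0' : (k%:R : rat) != 0 by rewrite pnatr_eq0 -lt0n.
have dN : @density (fat_cycle cl) None = n.+1%:R / q%:R.
  rewrite dE S_E mN invr1 !mul1r invf_div kE mulrBl divff // opprB.
  by rewrite addrCA subrr addr0.
exists (fat_cycle cl); split; last 1 first.
(* The edge [None] attains the maximum; the upper bound also has to cover the default value 0. *)
- apply/le_anti/andP; split; last by rewrite -dN; apply: le_bigmax.
  apply: bigmax_le => [|[[i j]|] _]; rewrite ?dN ?divr_ge0 ?ler0n //.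
  rewrite dE S_E mS.
  have -> : k%:R^-1 * (1 - k%:R^-1 / (q%:R / k%:R)) = (q%:R - 1) / k%:R / q%:R :> rat.
    by field; rewrite q0 k0'.
  rewrite ler_pM2r ?invr_gt0 ?ltr0n ?(leq_trans _ hpq) //.
  rewrite ler_pdivrMr ?ltr0n //.
  have -> : (q%:R : rat) = n.+1%:R + k%:R by rewrite kE; ring.
  have : (1 : rat) <= k%:R by rewrite ler1n.
  have : (1 : rat) <= n.+1%:R by rewrite ler1n.
  by nra.
(* Every class is inhabited, so [ord0] is an arbitrary choice of class to leave out. *)
- apply: (@fat_cycle_connected _ _ _ _ ord0); apply/fintype.subsetP => i _.
  have : (0 < multiplicity cl i)%N by [].
  by case/card_gt0P => e; rewrite inE => /eqP <-; apply: imset_f.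
exact: fat_cycle_planar.
Qed.
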